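(* Let $n\geq 1$ be an integer and let $\zeta\in\mathbb{R}$ be a real number that is not algebraic of degree $\leq n$. Then \[ w_{n}^{\ast}(\zeta)\geq w_{n,n+1}(\zeta) \qquad\text{and}\qquad \widehat{w}_{n}^{\ast}(\zeta)\geq \widehat{w}_{n,n+1}(\zeta). \]
   Context: For an algebraic number $\alpha$, $H(\alpha)$ denotes the largest absolute value of the coefficients of its minimal polynomial over $\mathbb{Z}$ with relatively prime integer coefficients. $w_{n}^{\ast}(\zeta)$ is the supremum of all real $\nu$ such that $\vert\zeta-\alpha\vert\leq H(\alpha)^{-\nu-1}$ has infinitely many solutions $\alpha$ algebraic of degree $\leq n$. $\widehat{w}_{n}^{\ast}(\zeta)$ is the supremum of all real $\nu$ such that for every sufficiently large $H$ there exists an algebraic number $\alpha$ of degree $\leq n$ with $H(\alpha)\leq H$ and $\vert\zeta-\alpha\vert\leq H(\alpha)^{-1}H^{-\nu}$. For $1\leq j\leq n+1$, $w_{n,j}(\zeta)$ (resp. $\widehat{w}_{n,j}(\zeta)$) is the supremum of all real $\nu$ such that the system $\vert y_{i}\vert\leq X$ ($1\leq i\leq n$), $\vert x+\zeta y_{1}+\zeta^{2}y_{2}+\cdots+\zeta^{n}y_{n}\vert\leq X^{-\nu}$ has $j$ linearly independent integer solutions $(x,y_{1},\ldots,y_{n})\in\mathbb{Z}^{n+1}$ for arbitrarily large values of $X$ (resp. for all sufficiently large $X$). *)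

(* Defs.v *)
From HB Require Import structures.
From mathcomp Require Import all_boot all_order all_algebra.
From mathcomp Require Import complex.
From mathcomp Require Import all_classical all_reals all_analysis.
Set Implicit Arguments. Unset Strict Implicit. Unset Printing Implicit Defensive.
Import Order.TTheory GRing.Theory Num.Theory.
Local Open Scope classical_set_scope.
Local Open Scope ring_scope.
Local Open Scope complex_scope.

Definition height (P : {poly int}) : int := \big[Num.max/0]_(i < size P) Num.norm (P`_i).

Definition minpolyZ_le (R : realType) (n : nat) (P : {poly int}) (alpha : R[i]) :=
  [/\ (1 < size P <= n.+1)%N,
      Num.norm (zcontents P) = 1,
      irreducible_poly (map_poly intr P : {poly rat}) &
      root (map_poly intr P : {poly R[i]}) alpha].

Definition alg_le_height (R : realType) (n : nat) (alpha : R[i]) (h : int) :=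
  exists P : {poly int}, minpolyZ_le n P alpha /\ height P = h.

Definition algebraic_le (R : realType) (n : nat) (alpha : R[i]) :=
  exists h : int, alg_le_height n alpha h.

Definition wstar (R : realType) (n : nat) (zeta : R) : \bar R :=
  ereal_sup [set nu%:E | nu in
    [set nu : R | ~ finite_set
      [set alpha : R[i] | exists h : int, alg_le_height n alpha h /\
         `|zeta%:C - alpha| <= ((h%:~R : R) `^ (- nu - 1))%:C ]]].

Definition whatstar (R : realType) (n : nat) (zeta : R) : \bar R :=
  ereal_sup [set nu%:E | nu in
    [set nu : R | exists H0 : R, forall H : R, H0 <= H ->
      exists (alpha : R[i]) (h : int), alg_le_height n alpha h /\
        (h%:~R : R) <= H /\
        `|zeta%:C - alpha| <= ((h%:~R : R) `^ (-1) * H `^ (- nu))%:C ]].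

Definition linform (R : realType) (n : nat) (zeta : R) (v : 'rV[int]_(n.+1)) : R :=
  \sum_(i < n.+1) (v 0 i)%:~R * zeta ^+ i.

Definition sys_sol (R : realType) (n j : nat) (zeta X nu : R)
  (M : 'M[int]_(j, n.+1)) :=
  forall k : 'I_j,
    (forall i : 'I_n.+1, i != ord0 -> ((Num.norm (M k i))%:~R : R) <= X) /\
    `|linform zeta (row k M)| <= X `^ (- nu).

Definition has_indep_sols (R : realType) (n j : nat) (zeta X nu : R) :=
  exists M : 'M[int]_(j, n.+1),
    row_free (map_mx intr M : 'M[rat]_(j, n.+1)) /\ sys_sol zeta X nu M.

Definition wnj (R : realType) (n j : nat) (zeta : R) : \bar R :=
  ereal_sup [set nu%:E | nu in
    [set nu : R | forall X0 : R, exists X : R, X0 <= X /\ has_indep_sols n j zeta X nu]].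

Definition whatnj (R : realType) (n j : nat) (zeta : R) : \bar R :=
  ereal_sup [set nu%:E | nu in
    [set nu : R | exists X0 : R, forall X : R, X0 <= X -> has_indep_sols n j zeta X nu]].

(* Main.v *)
Require Import Defs.
From HB Require Import structures.
From mathcomp Require Import all_boot all_order all_algebra.
From mathcomp Require Import complex.
From mathcomp Require Import all_classical all_reals all_analysis.
From mathcomp Require Import ring lra zify.
Import Order.TTheory GRing.Theory Num.Theory.
Local Open Scope classical_set_scope.
Local Open Scope ring_scope.
Local Open Scope complex_scope.
Set Implicit Arguments. Unset Strict Implicit. Unset Printing Implicit Defensive.

(** The idea: n+1 independent integer solutions at level H span a sublattice L of finite
    index in the integer polynomials of degree <= n, consisting of polynomials that are
    small at zeta.  Hence every residue class modulo 4L comes within O(1) basis vectors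
    of the real polynomial T(X - zeta), which vanishes at zeta and has derivative T.
    Taking T a large multiple of H and the class of X^n + 2, we get an integer
    polynomial w which is irreducible by Eisenstein's criterion at 2, has height O(H),
    and satisfies |w(zeta)| = O(H^-nu) and |w'(zeta)| >= cH.  As w'/w is the sum of the
    n terms 1 / (zeta - a) over the roots a, some root lies within O(H^(-nu-1)) of zeta.
    Exponents nu < 0 reduce to nu = 0, for which a unitriangular system of solutions
    always exists. *)

(** * Roots near a point where a polynomial is small against its derivative *)

(** This is the bound of |p'/p| by the sum of the 1/|z - a| with denominators cleared, so that p(z)
    = 0 needs no exception. *)
Lemma norm_deriv_prod_XsubC (F : numFieldType) (z d : F) (s : seq F) :
  0 <= d -> (forall a, a \in s -> d <= `|z - a|) ->
  `|(\prod_(a <- s) ('X - a%:P))^`().[z]| * d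
    <= (size s)%:R * `|(\prod_(a <- s) ('X - a%:P)).[z]|.
Proof.
move=> d0; elim: s => [|a s IHs] hs.
  by rewrite big_nil derivC hornerC normr0 !mul0r.
rewrite big_cons derivM derivXsubC mul1r !hornerE /=.
set p := \prod_(_ <- s) _ in IHs *.
have da : d <= `|z - a| by apply: hs; rewrite mem_head.
have {}IHs : `|p^`().[z]| * d <= (size s)%:R * `|p.[z]|.
  by apply: IHs => b bs; apply: hs; rewrite inE bs orbT.
apply: (le_trans (ler_wpM2r d0 (ler_normD _ _))).
rewrite mulrDl !normrM -[(size s).+1]add1n natrD mulrDl mul1r; apply: lerD.
  by rewrite mulrC ler_wpM2r.
by rewrite -mulrA [leRHS]mulrCA ler_wpM2l.
Qed.

(* In [norm_deriv_prod_XsubC] the constant is the degree; the larger constant [size p]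
   used here leaves the slack that excludes all roots being farther away. *)
Lemma exists_near_root (F : numClosedFieldType) (p : {poly F}) (z e : F) :
  0 <= e -> `|p.[z]| <= e * `|p^`().[z]| -> p != 0 ->
  exists2 a, root p a & `|z - a| <= (size p)%:R * e.
Proof.
move=> e0 hz p0; have [pz|pz] := eqVneq p.[z] 0.
  by exists z; [exact/rootP|rewrite subrr normr0 mulr_ge0].
have [s ps] := closed_field_poly_normal p.
have lp0 : lead_coef p != 0 by rewrite lead_coef_eq0.
have sp : size p = (size s).+1.
  by rewrite ps size_scale // size_prod_XsubC.
have rs a : a \in s -> root p a by move=> as_; rewrite ps rootZ // root_prod_XsubC.
have [/hasP[a as_ ha]|/hasPn hs] := boolP (has (fun a => `|z - a| <= (size p)%:R * e) s).
  by exists a => //; exact: rs.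
exfalso.
have := @norm_deriv_prod_XsubC _ z ((size p)%:R * e) s.
rewrite mulr_ge0 // => /(_ isT) H.
have {}H : `|p^`().[z]| * ((size p)%:R * e) <= (size s)%:R * `|p.[z]|.
  set q := \prod_(_ <- s) _ in H ps.
  have -> : p.[z] = lead_coef p * q.[z] by rewrite {1}ps hornerZ.
  have -> : p^`().[z] = lead_coef p * q^`().[z] by rewrite {1}ps derivZ hornerZ.
  rewrite !normrM -mulrA [leRHS]mulrCA ler_wpM2l // H // => a /hs.
  rewrite real_leNgt ?negbK; first exact: ltW.
    exact: normr_real.
  by rewrite realM ?realn ?ger0_real.
have := le_trans H (ler_wpM2l (ler0n _ _) hz).
have pe : 0 < `|p^`().[z]| * e.
  by rewrite mulrC (lt_le_trans _ hz) // normr_gt0.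
by rewrite mulrCA [e * _]mulrC ler_pM2r // sp ler_nat ltnn.
Qed.

(** * Rounding in a lattice spanned by integer rows *)

(** Flooring the coordinates of [u] in the basis of rows moves each of them by at most 1. *)
Lemma exists_int_rV_mod_rows (R : realType) (N : nat) (M : 'M[int]_N) (u : 'rV[R]_N) :
  row_free (map_mx intr M : 'M[rat]_N) ->
  exists v : 'rV[int]_N, exists t : 'rV[R]_N,
    (forall k, `|t 0 k| <= 1) /\
    map_mx intr v = u + t *m map_mx intr M.
Proof.
set Mr : 'M[R]_N := map_mx intr M; rewrite row_free_unit => uM.
have {}uM : Mr \in unitmx.
  have -> : Mr = map_mx (@ratr R) (map_mx intr M : 'M[rat]_N).
    by apply/matrixP => i j; rewrite !mxE ratr_int.
  by rewrite map_unitmx.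
pose c := u *m invmx Mr; pose f : 'rV[int]_N := map_mx Num.floor c.
exists (f *m M), (map_mx intr f - c); split=> [k|].
  have -> : (map_mx intr f - c) 0 k = (Num.floor (c 0 k))%:~R - c 0 k :> R.
    by rewrite !mxE.
  by have := floor_itv (c 0 k); rewrite intrD ler_norml; lra.
by rewrite map_mxM mulmxBl mulmxKV // addrC subrK.
Qed.

(** * Primitive parts and heights *)

(** By Gauss's lemma irreducibility passes to the rationals, where the content is a unit. *)
Lemma irreducible_zprimitive (p : {poly int}) :
  irreducible_poly p -> irreducible_poly (map_poly intr (zprimitive p) : {poly rat}).
Proof.
move=> pI; have p0 := irredp_neq0 pI; move/irreducible_rat_int: pI.
have -> : map_poly intr p = (zcontents p)%:~R *: map_poly intr (zprimitive p) :> {poly rat}.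
  by rewrite -map_polyZ -zpolyEprim.
have c0 : (zcontents p)%:~R != 0 :> rat by rewrite intr_eq0 zcontents_eq0.
rewrite /irreducible_poly size_scale // => -[-> H]; split=> // q q1 qp.
by rewrite -(eqp_rtrans (eqp_scale _ c0)) H // dvdpZr.
Qed.

Lemma height_ge (p : {poly int}) i : `|p`_i| <= height p.
Proof.
have [ip|/(nth_default 0) ->] := ltnP i (size p).
  exact: (le_bigmax _ (fun j : 'I_(size p) => `|p`_j|) (Ordinal ip)).
by rewrite normr0 bigmax_ge_id.
Qed.

Lemma height_leP (p : {poly int}) (b : int) :
  0 <= b -> (forall i, (i < size p)%N -> `|p`_i| <= b) -> height p <= b.
Proof. by move=> b0 pb; apply/bigmax_leP; split=> // i _; exact: pb. Qed.

Lemma height_gt0 (p : {poly int}) : p != 0 -> 0 < height p.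
Proof.
move=> p0; apply: lt_le_trans (height_ge p (size p).-1).
by rewrite normr_gt0 -lead_coefE lead_coef_eq0.
Qed.

Lemma height_zprimitive (p : {poly int}) : height (zprimitive p) <= height p.
Proof.
have [->|p0] := eqVneq p 0; first by rewrite zprimitive0.
apply: height_leP => [|i _]; first exact: le_trans (height_ge p 0%N).
apply: le_trans (height_ge p i).
rewrite {2}[p]zpolyEprim coefZ normrM ler_peMl //.
by rewrite -gtz0_ge1 normr_gt0 zcontents_eq0.
Qed.

Lemma height_realP (R : realDomainType) (p : {poly int}) (b : R) : 0 <= b ->
  (forall i, (i < size p)%N -> `|(p`_i)%:~R| <= b) -> (height p)%:~R <= b.
Proof.
move=> b0 pb; rewrite /height; elim/big_ind: _ => // [x y xb yb|i _].
  by rewrite maxEle; case: ifP.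
by rewrite intr_norm pb.
Qed.

(** * Integer polynomials in a residue class near a real polynomial *)

(** Rounding (q - E) / m makes [e] equal to m times a combination of the n+1 solutions with weights
    at most 1. Index 0 is left out because the system does not bound that entry. *)
Lemma exists_congr_approx (R : realType) (n : nat) (zeta X nu : R)
    (q : {poly R}) (E : {poly int}) (m : nat) :
  has_indep_sols n n.+1 zeta X nu ->
  (size q <= n.+1)%N -> (size E <= n.+1)%N -> (0 < m)%N ->
  exists2 v : {poly int}, (size v <= n.+1)%N &
    exists2 e : {poly R}, map_poly intr (E + m%:Z *: v) = q + e &
      [/\ (size e <= n.+1)%N,
          forall i, (0 < i <= n)%N -> `|e`_i| <= (m * n.+1)%:R * X &
          `|e.[zeta]| <= (m * n.+1)%:R * X `^ (- nu)].
Proof.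
move=> [M [Mfree Msol]] sq sE m_gt0.
have m0 : m%:R != 0 :> R by rewrite pnatr_eq0 -lt0n.
have [v [t [t1 vE]]] :=
  exists_int_rV_mod_rows (m%:R^-1 *: poly_rV (q - map_poly intr E)) Mfree.
have sum_le (f : 'I_n.+1 -> R) (b : R) : (forall k, `|f k| <= b) ->
    `|\sum_k t 0 k * f k| <= n.+1%:R * b.
  move=> fb; apply: le_trans (ler_norm_sum _ _ _) _.
  have -> : n.+1%:R * b = \sum_(k < n.+1) b.
    by rewrite sumr_const card_ord mulr_natl.
  apply: ler_sum => k _.
  by rewrite normrM -[b]mul1r ler_pM.
exists (rVpoly v); first exact: size_poly.
exists (m%:R *: rVpoly (t *m map_mx intr M)).
  rewrite rmorphD /= map_polyZ /= map_rVpoly vE linearD linearZ /=.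
  rewrite poly_rV_K ?scalerDr ?scalerA.
    by rewrite -[m%:Z%:~R]/(m%:R) divff // !scale1r addrA addrCA subrr addr0.
  rewrite (leq_trans (size_polyD _ _)) // geq_max sq size_polyN.
  by rewrite (leq_trans (size_poly _ _)).
split.
- by rewrite (leq_trans (size_scale_leq _ _)) // size_poly.
- move=> i /andP[i0 ilen]; rewrite coefZ.
  pose j : 'I_n.+1 := Ordinal (ilen : (i < n.+1)%N).
  have -> : (rVpoly (t *m map_mx intr M))`_i = (t *m map_mx intr M) 0 j.
    exact: (coef_rVpoly_ord _ j).
  rewrite normrM natrM -mulrA normr_nat.
  rewrite ler_wpM2l // mxE; apply: sum_le => k; rewrite mxE -intr_norm.
  by have [-> //] := Msol k; rewrite -val_eqE /= -lt0n.
- rewrite hornerZ normrM natrM -mulrA normr_nat ler_wpM2l //.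
  rewrite (horner_coef_wide _ (size_poly _ _)).
  have -> : \sum_(j < n.+1) (rVpoly (t *m map_mx intr M))`_j * zeta ^+ j =
            \sum_k t 0 k * linform zeta (row k M).
    under eq_bigr => j _ do rewrite coef_rVpoly_ord mxE mulr_suml.
    rewrite exchange_big /=; apply: eq_bigr => k _; rewrite mulr_sumr.
    by apply: eq_bigr => j _; rewrite !mxE mulrA.
  by apply: sum_le => k; have [_] := Msol k.
Qed.

Lemma norm_complex_real (R : realType) (x : R) : `|x%:C| = `|x|%:C.
Proof. by rewrite normc_def /= expr0n addr0 sqrtr_sqr. Qed.

(** * Irreducibility of the residue class of X^n + 2 modulo 4 *)

(** The coefficient of X^n is 1 modulo 4, hence nonzero. *)
Lemma size_Xn_plus2_add4 n (v : {poly int}) : (0 < n)%N -> (size v <= n.+1)%N ->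
  size ('X^n + 2%:P + 4%:Z *: v) = n.+1.
Proof.
move=> n0 sv; have n0' : (n == 0)%N = false by case: n n0 {sv}.
set w := _ + _; have wn : w`_n != 0.
  by rewrite !coefD coefZ coefXn coefC eqxx n0'; lia.
apply/eqP; rewrite eqn_leq; apply/andP; split; last first.
  by rewrite ltnNge; apply: contra wn => /(nth_default 0) ->.
rewrite (leq_trans (size_polyD _ _)) // geq_max.
rewrite (leq_trans (size_scale_leq _ _)) // andbT.
rewrite (leq_trans (size_polyD _ _)) // geq_max size_polyXn leqnn.
by rewrite (leq_trans (size_polyC_leq1 _)).
Qed.

(** Eisenstein at 2: the modulus 4 keeps the constant term at 2 modulo 4, so 2^2 does not divide
    it. *)
Lemma irreducible_Xn_plus2_add4 n (v : {poly int}) :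
  (0 < n)%N -> (size v <= n.+1)%N ->
  irreducible_poly ('X^n + 2%:P + 4%:Z *: v).
Proof.
move=> n0 sv; have sw := size_Xn_plus2_add4 n0 sv.
have n0' : (n == 0)%N = false by case: n n0 {sv sw}.
apply: (@eisenstein_crit 2) => //.
- by rewrite sw; case: n n0 {sv sw n0'}.
- by rewrite lead_coefE sw /= !coefD coefZ coefXn coefC eqxx n0'; lia.
- by rewrite !coefD coefZ coefXn coefC eq_sym n0' eqxx; lia.
- move=> i; rewrite sw /= => /ltn_eqF ni.
  by rewrite !coefD coefZ coefXn coefC ni; case: ifP => _; lia.
Qed.

(** * From a full system of solutions to one algebraic approximation *)

(** Differentiation kills the constant term, the only coefficient that the system leaves free. *)
Lemma norm_deriv_horner_le (R : realDomainType) n (e : {poly R}) (x b : R) :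
  (size e <= n.+1)%N -> (forall i, (0 < i <= n)%N -> `|e`_i| <= b) ->
  `|e^`().[x]| <= b * \sum_(i < n) i.+1%:R * `|x| ^+ i.
Proof.
move=> se eb; have se' : (size e^`() <= n)%N.
  by rewrite (leq_trans (size_poly _ _)) //; case: (size e) se.
rewrite (horner_coef_wide _ se') (le_trans (ler_norm_sum _ _ _)) // mulr_sumr.
apply: ler_sum => i _; rewrite coef_deriv normrM normrX normrMn mulrA.
by rewrite ler_wpM2r ?exprn_ge0 // mulr_natr lerMn2r eb ?orbT //=.
Qed.

(** The constant term is recovered from the value at [x] and the other coefficients. *)
Lemma norm_coef0_le (R : realDomainType) n (e : {poly R}) (x b : R) :
  (size e <= n.+1)%N -> (forall i, (0 < i <= n)%N -> `|e`_i| <= b) ->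
  `|e`_0| <= `|e.[x]| + b * \sum_(i < n) `|x| ^+ i.+1.
Proof.
move=> se eb; rewrite (horner_coef_wide _ se) big_ord_recl mulr1.
set s := \sum_(i < n) _; rewrite -[in leLHS](addrK s e`_0).
rewrite (le_trans (ler_normB _ _)) // lerD2l.
rewrite (le_trans (ler_norm_sum _ _ _)) // mulr_sumr; apply: ler_sum => i _.
by rewrite normrM normrX ler_wpM2r ?exprn_ge0 // eb //=.
Qed.

(** An Eisenstein polynomial at 2 may still have odd content, whereas heights are read off primitive
    polynomials. *)
Lemma alg_le_height_zprimitive (R : realType) n (p : {poly int}) (alpha : R[i]) :
  irreducible_poly p -> (size p <= n.+1)%N -> root (map_poly intr p) alpha ->
  alg_le_height n alpha (height (zprimitive p)).
Proof.
move=> pI sp pa; have p0 := irredp_neq0 pI.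
exists (zprimitive p); split=> //; split.
- by rewrite size_zprimitive sp pI.
- by rewrite zcontents_primitive p0.
- exact: irreducible_zprimitive.
- move: pa; rewrite {1}[p]zpolyEprim map_polyZ rootZ //.
  by rewrite intr_eq0 zcontents_eq0.
Qed.

(** [K] depends on [n] and [zeta] alone, so that a small loss in the exponent can later absorb
    it. *)
Lemma exists_algebraic_approx (R : realType) (n : nat) (zeta : R) : (0 < n)%N ->
  exists2 K : R, 1 <= K & forall X nu : R, 1 <= X -> 0 <= nu ->
    has_indep_sols n n.+1 zeta X nu ->
    exists alpha : R[i], exists h : int,
      [/\ alg_le_height n alpha h, h%:~R <= K * X &
          `|zeta%:C - alpha| <= (K * X `^ (- nu - 1))%:C].
Proof.
move=> n0.
pose b : R := (4 * n.+1)%:R.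
pose D : R := \sum_(i < n) i.+1%:R * `|zeta| ^+ i.
pose S : R := \sum_(i < n) `|zeta| ^+ i.+1.
have D0 : 0 <= D by apply: sumr_ge0 => i _; rewrite mulr_ge0 ?exprn_ge0.
have S0 : 0 <= S by apply: sumr_ge0 => i _; rewrite exprn_ge0.
have z0 : 0 <= `|zeta| by [].
have bn : n.+1%:R <= b by rewrite ler_nat leq_pmull.
have n1 : 1 <= n.+1%:R :> R by rewrite ler1n.
have b0 : 0 < b by rewrite (lt_le_trans _ bn).
(* In units of b * X, the product will bound the coefficients of [q], and 1 + S those of [e]. *)
pose k := (D + 1) * (1 + `|zeta|) + 1 + S.
have k1 : 1 <= k.
  have : 0 <= (D + 1) * (1 + `|zeta|) by rewrite mulr_ge0 ?addr_ge0.
  by rewrite /k; lra.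
have bK : b <= b * k by rewrite ler_peMr // ltW.
exists (b * k) => [|X nu X1 nu0 sol]; first by lra.
have X0 : 0 < X by lra.
(* Thus |e(zeta)| is O(X) too, which bounds the constant term of [e]. *)
have Xnu : X `^ (- nu) <= X.
  by rewrite (le_trans _ X1) // -(powRr0 X) ler_powR // oppr_le0.
(* As |e'(zeta)| <= b * X * D, the slope b * X * (D + 1) leaves |w'(zeta)| >= b * X. *)
pose q : {poly R} := (b * X * (D + 1)) *: ('X - zeta%:P).
have T0 : 0 <= b * X * (D + 1) by rewrite !mulr_ge0 ?addr_ge0 // ltW.
have sq : (size q <= n.+1)%N.
  by rewrite (leq_trans (size_scale_leq _ _)) // size_XsubC.
have sE : (size ('X^n + 2%:P : {poly int})%R <= n.+1)%N.
  by rewrite (leq_trans (size_polyD _ _)) // geq_max size_polyXn leqnn size_polyC.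
have [v sv [e we [se eb ez]]] := exists_congr_approx sol sq sE (isT : (0 < 4)%N).
rewrite -/b in eb ez.
have wI := irreducible_Xn_plus2_add4 n0 sv.
have sw := size_Xn_plus2_add4 n0 sv.
set w := 'X^n + _ + _ in we wI sw.
have w0 := irredp_neq0 wI.
have wz : (map_poly intr w).[zeta] = e.[zeta] by rewrite we !hornerE subrr mulr0 add0r.
have w'z : b * X <= `|(map_poly intr w)^`().[zeta]|.
  rewrite we derivD derivZ derivXsubC hornerD hornerZ hornerC mulr1.
  apply: le_trans (lerB_normD _ _); rewrite ger0_norm //.
  by have := norm_deriv_horner_le zeta se eb; rewrite -/D; lra.
(* This is the ratio of the bounds b * X^(-nu) for |w(zeta)| and b * X for |w'(zeta)|. *)
pose d := X `^ (- nu - 1).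
have d0 : 0 <= d by exact: powR_ge0.
have dX : d * X = X `^ (- nu).
  have XD : X `^ (- nu - 1 + 1) = d * X `^ 1 by rewrite powRD // (gt_eqF X0) implybT.
  by rewrite subrK powRr1 ?ltW in XD.
have wd : `|(map_poly intr w).[zeta]| <= d * `|(map_poly intr w)^`().[zeta]|.
  rewrite wz (le_trans ez) // -dX mulrCA ler_wpM2l //.
have mapC : map_poly intr w = map_poly (real_complex R) (map_poly intr w).
  by rewrite -map_poly_comp; apply: eq_map_poly => x /=; rewrite rmorph_int.
have [|||alpha ra za] := @exists_near_root R[i] (map_poly intr w) zeta%:C d%:C.
- by rewrite ler0c.
- rewrite mapC deriv_map !horner_map !norm_complex_real -rmorphM lecR.
  exact: wd.
- by rewrite mapC map_poly_eq0 -size_poly_eq0 size_map_inj_poly ?sw //; exact: intr_inj.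
exists alpha, (height (zprimitive w)); split.
- by apply: alg_le_height_zprimitive; rewrite ?sw.
- apply: (@le_trans _ _ (height w)%:~R); first by rewrite ler_int height_zprimitive.
  apply: height_realP => [|i _]; first by rewrite !mulr_ge0 ?ltW //; lra.
  have -> : (w`_i)%:~R = q`_i + e`_i :> R by rewrite -coefD -we coef_map.
  have qi : `|q`_i| <= b * X * (D + 1) * (1 + `|zeta|).
    rewrite coefZ normrM ger0_norm // ler_wpM2l // coefB coefX coefC.
    rewrite (le_trans (ler_normB _ _)) // lerD //.
      by case: (i == 1)%N; rewrite ?normr1 ?normr0.
    by case: (i == 0)%N; rewrite ?normr0.
  have ei : `|e`_i| <= b * X * (1 + S).
    have [->|i_gt0] := posnP i.
      have := norm_coef0_le zeta se eb; rewrite -/S => /le_trans; apply.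
      by rewrite mulrDr mulr1 lerD2r (le_trans ez) // ler_wpM2l // ltW.
    have [ilen|nlti] := leqP i n.
      have := eb i; rewrite i_gt0 ilen => /(_ isT) /le_trans; apply.
      by rewrite ler_peMr ?mulr_ge0 ?(ltW b0) ?(ltW X0) //; lra.
    by rewrite nth_default ?(leq_trans se) // normr0 !mulr_ge0 ?ltW //; lra.
  rewrite (le_trans (ler_normD _ _)) // (le_trans (lerD qi ei)) //.
  by rewrite /k le_eqVlt; apply/orP; left; apply/eqP; ring.
(* The factor n+1 lost in locating the root is at most b <= b * k. *)
- apply: le_trans za _; rewrite -(rmorph_nat (real_complex R)) -rmorphM lecR.
  rewrite ler_wpM2r // size_map_inj_poly ?sw //; last exact: intr_inj.
  lra.
Qed.

(** * Tools for passing from single approximations to exponents *)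

Lemma alg_le_height_ge1 (R : realType) n (alpha : R[i]) (h : int) :
  alg_le_height n alpha h -> 1 <= h%:~R :> R.
Proof.
move=> [P [[/andP[P1 _] _ _ _] <-]].
by rewrite ler1z -gtz0_ge1 height_gt0 // -size_poly_gt0 ltnW.
Qed.

(* The rows are the coefficients of [1] and of the [X^i - floor (zeta ^ i)]. *)
Lemma has_indep_sols0 (R : realType) n (zeta X : R) :
  1 <= X -> has_indep_sols n n.+1 zeta X 0.
Proof.
move=> X1.
(* Index 0 is set apart: the floor of zeta^0 is 1 and would make row 0 vanish. *)
pose c (i : 'I_n.+1) : int := if i == ord0 then 0 else Num.floor (zeta ^+ i).
pose M : 'M[int]_n.+1 := \matrix_(i, j) ((i == j)%:R - (j == ord0)%:R * c i).
exists M; split.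
  rewrite row_free_unit unitmxE.
  have trigM : is_trig_mx (map_mx intr M : 'M[rat]_n.+1).
    apply/is_trig_mxP => i j ij; rewrite !mxE /c.
    have /negPf -> : j != ord0 by rewrite -val_eqE /= -lt0n (leq_ltn_trans _ ij).
    by rewrite mul0r subr0 -val_eqE /= (ltn_eqF ij).
  rewrite (det_trig trigM) big1 ?unitr1 // => i _.
  by rewrite !mxE eqxx /c; case: eqP => _; rewrite ?mulr0 ?mul0r subr0.
move=> i; split=> [j /negPf j0|].
  rewrite mxE j0 mul0r subr0; apply: le_trans X1.
  by case: (i == j); rewrite ?normr1 ?normr0.
have -> : linform zeta (row i M) = zeta ^+ i - (c i)%:~R.
  rewrite /linform.
  under eq_bigr => j _ do rewrite !mxE rmorphB rmorphM /= !rmorph_nat mulrBl.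
  rewrite big_split /= sumrN (bigD1 i) //= eqxx mul1r big1 ?addr0 => [|j /negPf].
    rewrite (bigD1 ord0) //= mulr1 mul1r big1 ?addr0 // => j /negPf ->.
    by rewrite !mul0r.
  by rewrite eq_sym => ->; rewrite mul0r.
rewrite oppr0 powRr0 /c; case: eqP => [->|_]; first by rewrite subr0 normr1.
by have := floor_itv (zeta ^+ i); rewrite intrD ler_norml; lra.
Qed.

(** For large [X] the factor X^e absorbs any constant; it will be applied to powers of [K]. *)
Lemma powR_ge_large (R : realType) (A e X : R) :
  0 < e -> 0 <= A -> A `^ e^-1 <= X -> A <= X `^ e.
Proof.
move=> e0 A0 AX; rewrite -[A](powRr1 A0) -(@mulVf _ e) ?gt_eqF // powRrM.
rewrite ge0_ler_powR ?nnegrE ?powR_ge0 //; first exact: ltW.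
exact: le_trans (powR_ge0 _ _) AX.
Qed.

(** Serves to show that points tending to [z] without reaching it cannot all lie in a finite set. *)
Lemma exists_dist_lb (R : realType) (z : R[i]) (s : seq R[i]) :
  exists2 d : R, 0 < d & forall a, a \in s -> a != z -> d%:C <= `|z - a|.
Proof.
elim: s => [|a s [d d0 ds]]; first by exists 1.
have [->|az] := eqVneq a z.
  by exists d => // b; rewrite inE => /predU1P[->|/ds //]; rewrite eqxx.
have: 0 < `|z - a| by rewrite normr_gt0 subr_eq0 eq_sym.
rewrite normc_def ltcR; set r := Num.sqrt _ => r0.
exists (Num.min d r) => [|b]; first by rewrite lt_min d0.
rewrite inE => /predU1P[-> _|bs bz]; first by rewrite normc_def lecR ge_min lexx orbT.
by apply: le_trans (ds _ bs bz); rewrite lecR ge_min lexx.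
Qed.

Lemma ler_powRN (R : realType) (x y r : R) :
  0 < x -> x <= y -> 0 <= r -> y `^ (- r) <= x `^ (- r).
Proof.
move=> x0 xy r0; have y0 := lt_le_trans x0 xy.
by rewrite !powRN lef_pV2 ?posrE ?powR_gt0 // ge0_ler_powR ?nnegrE // ltW.
Qed.

(** * The two exponent inequalities *)

(** A finite set of such numbers, none equal to [zeta], would keep a positive distance from it, but
    large [X] yields members arbitrarily close. *)
Lemma wstar_set_mem (R : realType) n (zeta nu e : R) :
  (0 < n)%N -> ~ algebraic_le n zeta%:C -> 0 <= nu -> 0 < e <= 1 ->
  (forall X0 : R, exists X, X0 <= X /\ has_indep_sols n n.+1 zeta X nu) ->
  ~ finite_set [set alpha : R[i] | exists h : int, alg_le_height n alpha h /\
      `|zeta%:C - alpha| <= ((h%:~R : R) `^ (- (nu - e) - 1))%:C ].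
Proof.
move=> n0 zalg nu0 /andP[e0 e1] sols; have [K K1 HK] := exists_algebraic_approx zeta n0.
have K0 : 0 < K by lra.
move=> /finite_seqP[s sE]; have [d d0 ds] := exists_dist_lb zeta%:C s.
(* K^(nu - e + 1) comes from replacing h by K * X, the last factor K from the bound on |zeta -
   alpha|. *)
pose A := K `^ (nu - e + 2).
(* The summands give X >= 1, K / X < d and A <= X^e in turn. *)
have [X [+ sol]] := sols (1 + K / d + A `^ e^-1).
have Kd0 : 0 < K / d by rewrite divr_gt0.
have A0 : 0 <= A `^ e^-1 by exact: powR_ge0.
move=> leX; have X1 : 1 <= X by lra.
have X0 : 0 < X by lra.
have [alpha [h [ah hX az]]] := HK X nu X1 nu0 sol.
have h1 := alg_le_height_ge1 ah; have h0 : 0 < h%:~R :> R by lra.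
have : alpha \in s.
  suff : [set` s] alpha by [].
  rewrite -sE; exists h; split=> //; apply: le_trans az _; rewrite lecR.
  (* As e <= 1, nu - e + 1 is nonnegative and h may be replaced by its upper bound K * X. *)
  have -> : - (nu - e) - 1 = - (nu - e + 1) by ring.
  apply: le_trans (ler_powRN h0 hX _); last by lra.
  rewrite (powRM _ (ltW K0) (ltW X0)).
  have AX : A <= X `^ e by apply: powR_ge_large => //; [exact: powR_ge0|lra].
  have -> : - (nu - e + 1) = e + (- nu - 1) by ring.
  rewrite [X `^ (e + _)]powRD ?(gt_eqF X0) ?implybT // mulrA.
  rewrite ler_wpM2r ?powR_ge0 //.
  apply: le_trans (ler_wpM2l (powR_ge0 _ _) AX).
  rewrite /A -powRD ?(gt_eqF K0) ?implybT //.
  have -> : e + (- nu - 1) + (nu - e + 2) = 1 by ring.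
  by rewrite powRr1 // ltW.
move=> /ds H; have {H} : d%:C <= `|zeta%:C - alpha|.
  by apply: H; apply: contra_notN zalg => /eqP <-; exists h.
move=> /le_trans /(_ az); rewrite lecR; apply/negP; rewrite -ltNge.
have XV : X `^ (- nu - 1) <= X^-1.
  by rewrite -(powR_inv1 (ltW X0)) ler_powR //; lra.
apply: le_lt_trans (ler_wpM2l (ltW K0) XV) _.
by rewrite ltr_pdivrMr // mulrC -ltr_pdivrMr //; lra.
Qed.

(** Taking X = H / K gives h <= H; then K * X^(-nu-1) = K^(nu+2) * H^(-nu-1), and H^e absorbs the
    constant. *)
Lemma whatstar_set_mem (R : realType) n (zeta nu e : R) :
  (0 < n)%N -> 0 <= nu -> 0 < e ->
  (exists X0 : R, forall X, X0 <= X -> has_indep_sols n n.+1 zeta X nu) ->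
  exists H0 : R, forall H : R, H0 <= H ->
      exists (alpha : R[i]) (h : int), alg_le_height n alpha h /\
        (h%:~R : R) <= H /\
        `|zeta%:C - alpha| <= ((h%:~R : R) `^ (-1) * H `^ (- (nu - e)))%:C.
Proof.
move=> n0 nu0 e0 [X0 sols]; have [K K1 HK] := exists_algebraic_approx zeta n0.
have K0 : 0 < K by lra.
pose A := K `^ (nu + 2).
(* The first term makes H / K at least 1 and at least X0, the second gives A <= H^e. *)
exists (K * (1 + `|X0|) + A `^ e^-1) => H leH.
have A0 : 0 <= A `^ e^-1 by exact: powR_ge0.
have KH : K * (1 + `|X0|) <= H by lra.
have KX0 : K <= K * (1 + `|X0|) by rewrite ler_peMr ?(ltW K0) // lerDl.
have Hpos : 0 < H by lra.
have X1 : 1 + `|X0| <= H / K by rewrite ler_pdivlMr // mulrC.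
have nX0 : 0 <= `|X0| by [].
have lX0 : X0 <= `|X0| by exact: ler_norm.
have HK1 : 1 <= H / K by lra.
have HX0 : X0 <= H / K by lra.
have [alpha [h [ah hX az]]] := HK (H / K) nu HK1 nu0 (sols _ HX0).
have KHK : K * (H / K) = H by rewrite mulrC divfK // gt_eqF.
rewrite KHK in hX.
have h1 := alg_le_height_ge1 ah; have h0 : 0 < h%:~R :> R by lra.
exists alpha, h; split=> //; split=> //; apply: le_trans az _; rewrite lecR.
have hH : H `^ (-1) <= h%:~R `^ (-1) by exact: ler_powRN.
apply: le_trans (ler_wpM2r (powR_ge0 _ _) hH).
rewrite powRM ?invr_ge0 ?(ltW Hpos) ?(ltW K0) // -(powR_inv1 (ltW K0)) -powRrM.
have AH : A <= H `^ e by apply: powR_ge_large => //; [exact: powR_ge0|lra].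
have -> : -1 * (- nu - 1) = nu + 1 by ring.
rewrite -powRD ?(gt_eqF Hpos) ?implybT //.
have -> : -1 + - (nu - e) = (- nu - 1) + e by ring.
rewrite [H `^ (_ + e)]powRD ?(gt_eqF Hpos) ?implybT // mulrCA.
rewrite ler_wpM2l ?powR_ge0 // (le_trans _ AH) //.
rewrite -{1}[K](powRr1 (ltW K0)) -powRD ?(gt_eqF K0) ?implybT //.
by rewrite /A le_eqVlt; apply/orP; left; apply/eqP; congr (_ `^ _); ring.
Qed.

(** Arbitrarily small losses do not affect a supremum; the cap at 1 keeps nu - e + 1 nonnegative for
    nu >= 0. *)
Lemma le_ereal_sup_image (R : realType) (A B : set R) :
  (forall x e : R, A x -> 0 < e <= 1 -> exists2 y, x - e <= y & B y) ->
  (ereal_sup [set x%:E | x in A] <= ereal_sup [set x%:E | x in B])%E.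
Proof.
move=> AB; apply: ge_ereal_sup => _ [x Ax <-]; apply/lee_subgt0Pr => e e0.
have [|y xy By] := AB x (Num.min e 1) Ax.
  by rewrite lt_min e0 ltr01 ge_min lexx orbT.
apply: (@le_trans _ _ y%:E); last by apply: ereal_sup_ubound; exists y.
rewrite -EFinB lee_fin (le_trans _ xy) // lerB // ge_min lexx.
by [].
Qed.

Local Open Scope ereal_scope.

Theorem theorem1 (R : realType) (n : nat) (zeta : R) :
  (1 <= n)%N -> ~ algebraic_le n zeta%:C ->
  wnj n n.+1 zeta <= wstar n zeta /\ whatnj n n.+1 zeta <= whatstar n zeta.
Proof.
move=> n0 zalg.
split; apply: le_ereal_sup_image => nu e /= sols e01; exists (Num.max nu 0 - e)%R.
- by rewrite lerD2r le_max lexx.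
- apply: wstar_set_mem => //; first by rewrite le_max lexx orbT.
  case: (leP nu 0%R) => _ X0 //; exists (Num.max X0 1)%R.
  by split; [rewrite le_max lexx|apply: has_indep_sols0; rewrite le_max lexx orbT].
- by rewrite lerD2r le_max lexx.
- have /andP[e0 _] := e01.
  apply: whatstar_set_mem => //; first by rewrite le_max lexx orbT.
  by case: (leP nu 0%R) => _ //; exists 1%R => X; exact: has_indep_sols0.
Qed.
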